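(* Let $(K,\phi)$ be a one vertex Kan complex with $\pi=\pi_1(K,\phi)$ and let $H\le\pi$ be a normal subgroup. Let $G$ be a finite group, $\varphi\colon G\to\operatorname{Aut}(\pi/H)$ a homomorphism, and $$1\longrightarrow\pi/H\longrightarrow L\longrightarrow G\longrightarrow1$$ the split extension corresponding to $\varphi$. Then there is a one vertex Kan complex with a simplicial $G$-action whose associated split extension is the given one. Precisely: there are a one vertex Kan complex $(K',\phi')$ with a simplicial action of $G$, and a normal subgroup $H'$ of $\pi'=\pi_1(K',\phi')$ with $g_*(H')=H'$ for all $g\in G$, such that the split extension $1\to\pi'/H'\to L'\to G\to1$ associated with $(K',G,H')$, whose group $L'$ acts on the regular cover $\widetilde{K'}_{H'}$ covering the action of $G$ on $K'$, is the given extension, i.e. there are isomorphisms $\pi'/H'\cong\pi/H$ and $L'\cong L$ which together with $\mathrm{id}_G$ form an isomorphism of extensions.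
   Context: A one vertex Kan complex $(K,\phi)$ is a Kan complex with exactly one $0$-simplex $\phi$. Every $1$-simplex $x$ represents a class $[x]\in\pi_1(K,\phi)$, and multiplication is taken with the convention $[\partial_1 z]=[\partial_0 z][\partial_2 z]$ for every $2$-simplex $z$. The split extension corresponding to a homomorphism $\varphi\colon G\to\operatorname{Aut}(N)$ is the semidirect product $L=N\times G$ with multiplication $(a,f)(b,g)=(a\,\varphi(f)(b),fg)$, with the evident inclusion of $N$ and projection onto $G$. The extension associated with $(K',G,H')$: a simplicial action of $G$ on a one vertex Kan complex $(K',\phi')$ (a left action by simplicial automorphisms) induces $g\mapsto g_*\in\operatorname{Aut}(\pi')$, $g_*[x]=[gx]$. If $H'\trianglelefteq\pi'$ satisfies $g_*(H')=H'$ for all $g$, this gives $\varphi'\colon G\to\operatorname{Aut}(\pi'/H')$, and $L'$ is the semidirect product corresponding to $\varphi'$. The regular cover $\widetilde{K'}_{H'}$ has $n$-simplices $K'_n\times\pi'/H'$ with $\partial_i(x,\overline\alpha)=(\partial_ix,\overline\alpha)$ for $0\le i<n$, $\partial_n(x,\overline\alpha)=(\partial_nx,[\partial_0^{\,n-1}x]^{-1}\overline\alpha)$, $s_i(x,\overline\alpha)=(s_ix,\overline\alpha)$. The group $L'$ acts on it by $(\overline\alpha,f)\cdot(x,\overline\sigma)=(fx,\varphi'(f)(\overline\sigma)\,\overline\alpha^{-1})$, which extends the deck transformation action of $\pi'/H'$ and covers the $G$-action on $K'$ under $(x,\overline\alpha)\mapsto x$. *)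

(* Defs.v *)
From HB Require Import structures.
From mathcomp Require Import all_boot.
From mathcomp Require Import boolp classical_sets.

Set Implicit Arguments.
Unset Strict Implicit.
Unset Printing Implicit Defensive.

Local Open Scope group_scope.
Local Open Scope quotient_scope.

(* [groupType] is MathComp's class of arbitrary, possibly infinite, groups.   *)

Record normal_subgroup (P : groupType) := NormalSubgroup {
  nsub :> groupClosed P;
  nsub_conj : forall x y : P, x \in nsub -> x ^ y \in nsub
}.

Section Quotient.
Variables (P : groupType) (H : normal_subgroup P).

Definition same_coset (x y : P) : bool := x^-1 * y \in nsub H.

Lemma same_coset_refl : reflexive same_coset.
Proof. by move=> x; rewrite /same_coset mulVg gpred1. Qed.

Lemma same_coset_sym : symmetric same_coset.
Proof. by move=> x y; rewrite /same_coset -gpredV invgM invgK. Qed.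

Lemma same_coset_trans : transitive same_coset.
Proof.
move=> y x z xy yz; rewrite /same_coset.
have -> : x^-1 * z = (x^-1 * y) * (y^-1 * z) by rewrite mulgA mulgK.
exact: gpredM.
Qed.

Canonical same_coset_equiv :=
  EquivRel same_coset same_coset_refl same_coset_sym same_coset_trans.

Definition quotient_group : Type := {eq_quot same_coset_equiv}.

HB.instance Definition _ := Choice.on quotient_group.
HB.instance Definition _ := EqQuotient.on quotient_group.

Definition coset (x : P) : quotient_group := \pi_quotient_group x.

Lemma coset_eq x y : coset x = coset y <-> x^-1 * y \in nsub H.
Proof. by split=> [/eqquotP|?]; last apply/eqquotP. Qed.

Lemma coset_repr (a : quotient_group) : coset (repr a) = a.
Proof. exact: reprK. Qed.

Lemma cosetP (a : quotient_group) : exists x, a = coset x.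
Proof. by exists (repr a); rewrite coset_repr. Qed.

Definition quotient_one : quotient_group := coset 1.
Definition quotient_inv (a : quotient_group) : quotient_group :=
  coset (repr a)^-1.
Definition quotient_mul (a b : quotient_group) : quotient_group :=
  coset (repr a * repr b).

Lemma quotient_invE x : quotient_inv (coset x) = coset x^-1.
Proof.
apply/coset_eq; rewrite invgK.
have /coset_eq e : coset (repr (coset x)) = coset x by exact: coset_repr.
have -> : repr (coset x) * x^-1 =
          ((repr (coset x))^-1 * x)^-1 ^ (repr (coset x))^-1.
  by rewrite /conjg invgK invgM invgK mulgA -!mulgA mulgV mulg1.
by apply: nsub_conj; rewrite gpredV.
Qed.

Lemma quotient_mulE x y : quotient_mul (coset x) (coset y) = coset (x * y).
Proof.
apply/coset_eq.
have /coset_eq ex : coset (repr (coset x)) = coset x by exact: coset_repr.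
have /coset_eq ey : coset (repr (coset y)) = coset y by exact: coset_repr.
set x' := repr (coset x) in ex *; set y' := repr (coset y) in ey *.
have -> : (x' * y')^-1 * (x * y) = ((x'^-1 * x) ^ y') * (y'^-1 * y).
  by rewrite /conjg invgM -!mulgA mulVKg.
by apply: gpredM => //; apply: nsub_conj.
Qed.

Lemma quotient_mulA : associative quotient_mul.
Proof.
move=> a b c; have [x ->] := cosetP a; have [y ->] := cosetP b.
by have [z ->] := cosetP c; rewrite !quotient_mulE mulgA.
Qed.
Lemma quotient_mul1g : left_id quotient_one quotient_mul.
Proof. by move=> a; have [x ->] := cosetP a; rewrite quotient_mulE mul1g. Qed.
Lemma quotient_mulg1 : right_id quotient_one quotient_mul.
Proof. by move=> a; have [x ->] := cosetP a; rewrite quotient_mulE mulg1. Qed.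
Lemma quotient_mulVg : left_inverse quotient_one quotient_inv quotient_mul.
Proof.
by move=> a; have [x ->] := cosetP a; rewrite quotient_invE quotient_mulE mulVg.
Qed.
Lemma quotient_mulgV : right_inverse quotient_one quotient_inv quotient_mul.
Proof.
by move=> a; have [x ->] := cosetP a; rewrite quotient_invE quotient_mulE mulgV.
Qed.

HB.instance Definition _ := isGroup.Build quotient_group
  quotient_mulA quotient_mul1g quotient_mulg1 quotient_mulVg quotient_mulgV.

Lemma cosetM x y : coset (x * y) = coset x * coset y.
Proof. by rewrite -quotient_mulE. Qed.

HB.instance Definition _ :=
  isMultiplicative.Build P quotient_group coset cosetM.

Lemma coset1 : coset 1 = 1.
Proof. by []. Qed.

End Quotient.

Section Aut.
Variable N : groupType.

Record aut := Aut {
  aut_fun :> N -> N;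
  aut_inv : N -> N;
  aut_funM : {morph aut_fun : x y / x * y};
  aut_funK : cancel aut_fun aut_inv;
  aut_invK : cancel aut_inv aut_fun
}.

Lemma autP (f g : aut) : f =1 g -> f = g.
Proof.
case: f g => [f f' fM fK f'K] [g g' gM gK g'K] /= fg.
have efg : f = g by apply/funext.
have efg' : f' = g'.
  by apply/funext => x; rewrite -{2}(f'K x) efg gK.
by case: _ / efg in fM fK f'K gM gK g'K *; case: _ / efg' in fK f'K gK g'K *;
   congr Aut; apply: Prop_irrelevance.
Qed.

HB.instance Definition _ := gen_eqMixin aut.
HB.instance Definition _ := gen_choiceMixin aut.

Lemma aut_invM (f : aut) : {morph aut_inv f : x y / x * y}.
Proof.
by move=> x y; apply: (can_inj (aut_funK f)); rewrite aut_funM !aut_invK.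
Qed.

Definition aut_one : aut :=
  @Aut id id (fun _ _ => erefl) (fun=> erefl) (fun=> erefl).
Definition aut_V (f : aut) : aut :=
  @Aut (aut_inv f) f (aut_invM f) (@aut_invK f) (@aut_funK f).

Lemma aut_compM (f g : aut) : {morph f \o g : x y / x * y}.
Proof. by move=> x y /=; rewrite !aut_funM. Qed.

Definition aut_mul (f g : aut) : aut :=
  @Aut (f \o g) (aut_inv g \o aut_inv f) (aut_compM f g)
    (can_comp (@aut_funK f) (@aut_funK g))
    (can_comp (@aut_invK g) (@aut_invK f)).

Lemma aut_mulA : associative aut_mul.
Proof. by move=> f g h; apply: autP. Qed.
Lemma aut_mul1g : left_id aut_one aut_mul.
Proof. by move=> f; apply: autP. Qed.
Lemma aut_mulg1 : right_id aut_one aut_mul.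
Proof. by move=> f; apply: autP. Qed.
Lemma aut_mulVg : left_inverse aut_one aut_V aut_mul.
Proof. by move=> f; apply: autP => x /=; rewrite aut_funK. Qed.
Lemma aut_mulgV : right_inverse aut_one aut_V aut_mul.
Proof. by move=> f; apply: autP => x /=; rewrite aut_invK. Qed.

HB.instance Definition _ := isGroup.Build aut
  aut_mulA aut_mul1g aut_mulg1 aut_mulVg aut_mulgV.

Lemma autM_app (f g : aut) x : (f * g) x = f (g x).
Proof. by []. Qed.
Lemma aut1_app x : (1 : aut) x = x.
Proof. by []. Qed.

Lemma aut_fun1 (f : aut) : f 1 = 1.
Proof. by apply: (@mulgI _ (f 1)); rewrite -aut_funM !mulg1. Qed.
Lemma aut_funV (f : aut) x : f x^-1 = (f x)^-1.
Proof. by apply: (@mulgI _ (f x)); rewrite -aut_funM !mulgV aut_fun1. Qed.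

End Aut.

Lemma mult1 (G H : groupType) (f : {multiplicative G -> H}) : f 1 = 1.
Proof. by apply: (@mulgI _ (f 1)); rewrite -gmulfM !mulg1. Qed.

(* [phi] does not occur in the carrier, but keys the group law below.         *)
Definition semidirect (N G : groupType) (phi : {multiplicative G -> aut N}) :
  Type := (N * G)%type.

Section Semidirect.
Variables (N G : groupType) (phi : {multiplicative G -> aut N}).

HB.instance Definition _ := Choice.copy (semidirect phi) (N * G)%type.

Definition semidirect_one : semidirect phi := (1, 1).
Definition semidirect_mul (u v : semidirect phi) : semidirect phi :=
  (u.1 * phi u.2 v.1, u.2 * v.2).
Definition semidirect_inv (u : semidirect phi) : semidirect phi :=
  (phi u.2^-1 u.1^-1, u.2^-1).

Lemma semidirect_mulA : associative semidirect_mul.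
Proof.
move=> [a f] [b g] [c h]; congr pair => /=; last by rewrite mulgA.
by rewrite aut_funM gmulfM autM_app mulgA.
Qed.
Lemma semidirect_mul1g : left_id semidirect_one semidirect_mul.
Proof.
by move=> [a f]; rewrite /semidirect_mul /= mult1 aut1_app !mul1g.
Qed.
Lemma semidirect_mulg1 : right_id semidirect_one semidirect_mul.
Proof. by move=> [a f]; rewrite /semidirect_mul /= aut_fun1 !mulg1. Qed.
Lemma semidirect_mulVg :
  left_inverse semidirect_one semidirect_inv semidirect_mul.
Proof.
by move=> [a f]; rewrite /semidirect_mul /= -aut_funM !mulVg aut_fun1.
Qed.
Lemma semidirect_mulgV :
  right_inverse semidirect_one semidirect_inv semidirect_mul.
Proof.
move=> [a f]; rewrite /semidirect_mul /= -autM_app -gmulfM mulgV mult1.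
by rewrite aut1_app mulgV.
Qed.

HB.instance Definition _ := isGroup.Build (semidirect phi) semidirect_mulA
  semidirect_mul1g semidirect_mulg1 semidirect_mulVg semidirect_mulgV.

Definition sd_in (a : N) : semidirect phi := (a, 1).
Definition sd_proj (u : semidirect phi) : G := u.2.

Lemma sd_inM : {morph sd_in : a b / a * b}.
Proof.
move=> a b; congr pair; last by rewrite mulg1.
by rewrite /= mult1 aut1_app.
Qed.
Lemma sd_projM : {morph sd_proj : u v / u * v}.
Proof. by []. Qed.

HB.instance Definition _ :=
  isMultiplicative.Build N (semidirect phi) sd_in sd_inM.
HB.instance Definition _ :=
  isMultiplicative.Build (semidirect phi) G sd_proj sd_projM.

End Semidirect.

(* Face and degeneracy operators are indexed by [nat].  Only [face i] with    *)
(* [i <= n.+1] on (n+1)-simplices and [degen i] with [i <= n] on n-simplices  *)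
(* are meaningful; out-of-range values are junk, on which no axiom or         *)
(* definition depends.                                                        *)
Record sset := SSet {
  simplex :> nat -> Type;
  face : forall n : nat, nat -> simplex n.+1 -> simplex n;
  degen : forall n : nat, nat -> simplex n -> simplex n.+1;
  face_face : forall n i j (x : simplex n.+2), (i < j <= n.+2)%N ->
    face i (face j x) = face j.-1 (face i x);
  face_degen_lt : forall n i j (x : simplex n.+1), (i < j <= n.+1)%N ->
    face i (degen j x) = degen j.-1 (face i x);
  face_degen_id : forall n j (x : simplex n), (j <= n)%N ->
    face j (degen j x) = x;
  face_degen_succ : forall n j (x : simplex n), (j <= n)%N ->
    face j.+1 (degen j x) = x;
  face_degen_gt : forall n i j (x : simplex n.+1), (j.+1 < i <= n.+2)%N ->
    face i (degen j x) = degen j (face i.-1 x);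
  degen_degen : forall n i j (x : simplex n), (i <= j <= n)%N ->
    degen i (degen j x) = degen j.+1 (degen i x)
}.

(* The extension condition for horns of dimension at least 2; in dimension 1  *)
(* it holds in every simplicial set, see [horn1_filler].                      *)
Definition is_kan (K : sset) : Prop :=
  forall (n k : nat) (y : nat -> K n.+1), (k <= n.+2)%N ->
    (forall i j, (i < j <= n.+2)%N -> i != k -> j != k ->
       face i (y j) = face j.-1 (y i)) ->
    exists z : K n.+2, forall i, (i <= n.+2)%N -> i != k -> face i z = y i.

Lemma horn1_filler (K : sset) (k : nat) (y : nat -> K 0) : (k <= 1)%N ->
  exists z : K 1%N, forall i, (i <= 1)%N -> i != k -> face i z = y i.
Proof.
move=> k1; exists (degen 0 (y (1 - k)%N)) => i i1 ik.
have -> : (1 - k)%N = i by case: k i k1 i1 ik => [|[|k]] [|[|i]].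
case: i i1 {ik} => [|[|i]] // _; first exact: face_degen_id.
exact: face_degen_succ.
Qed.

Record kan1 := OneVertexKan {
  kan_sset :> sset;
  vertex : kan_sset 0;
  vertexP : forall v : kan_sset 0, v = vertex;
  kanP : is_kan kan_sset
}.

Section FundamentalGroup.
Variable K : kan1.
Implicit Types a b c x y z : K 1%N.

Definition const_loop : K 1%N := degen 0 (vertex K).

Definition triangle a b c : Prop :=
  exists w : K 2, [/\ face 0 w = a, face 1 w = b & face 2 w = c].

(* All 1-simplices are loops, so there is no condition on the faces of x, y.  *)
Definition homotopic x y : Prop := triangle const_loop x y.

Lemma vertex_eq (u v : K 0) : u = v.
Proof. by rewrite (vertexP u) (vertexP v). Qed.

Lemma horn2 (k : nat) (y : nat -> K 1%N) : (k <= 2)%N ->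
  exists w : K 2, forall i, (i <= 2)%N -> i != k -> face i w = y i.
Proof. by move=> k2; apply: kanP => // *; apply: vertex_eq. Qed.

Lemma triangle_mul a c : exists b, triangle a b c.
Proof.
have [w hw] := horn2 (fun i => if i == 0%N then a else c) (isT : 1 <= 2)%N.
by exists (face 1 w), w; split=> //; rewrite hw.
Qed.

Lemma triangle_divl b c : exists a, triangle a b c.
Proof.
have [w hw] := horn2 (fun i => if i == 1%N then b else c) (isT : 0 <= 2)%N.
by exists (face 0 w), w; split=> //; rewrite hw.
Qed.

Lemma triangle_divr a b : exists c, triangle a b c.
Proof.
have [w hw] := horn2 (fun i => if i == 0%N then a else b) (isT : 2 <= 2)%N.
by exists (face 2 w), w; split=> //; rewrite hw.
Qed.

Lemma triangle1l x : triangle const_loop x x.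
Proof.
exists (degen 1 x); split.
- by rewrite face_degen_lt //= (vertexP (face 0 x)).
- exact: face_degen_id.
- exact: face_degen_succ.
Qed.

Lemma triangle1r x : triangle x x const_loop.
Proof.
exists (degen 0 x); split; first exact: face_degen_id.
  exact: face_degen_succ.
by rewrite face_degen_gt //= (vertexP (face 1 x)).
Qed.

(* The edges p, q, r, s, t, u of a 3-simplex with faces (p,q,r), (p,s,t),     *)
(* (q,s,u), (r,t,u): any three of the faces give the fourth.                  *)
Section Fill.
Variables p q r s t u : K 1%N.

Lemma fill1 :
  triangle p q r -> triangle q s u -> triangle r t u -> triangle p s t.
Proof.
move=> [w0 [a0 b0 c0]] [w2 [a2 b2 c2]] [w3 [a3 b3 c3]].
have [v hv] : exists v : K 3, forall i, (i <= 3)%N -> i != 1%N ->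
    face i v = nth w0 [:: w0; w0; w2; w3] i.
  apply: kanP => // i j.
  case/andP; case: i j => [|[|[|i]]] [|[|[|[|j]]]] //= _ _ _ _; congruence.
exists (face 1 v); split.
- by rewrite (@face_face K _ 0 1) // hv //= a0.
- by have := @face_face K _ 1 2 v isT; rewrite /= hv //= b2.
- by have := @face_face K _ 1 3 v isT; rewrite /= hv //= b3.
Qed.

Lemma fill2 :
  triangle p q r -> triangle p s t -> triangle r t u -> triangle q s u.
Proof.
move=> [w0 [a0 b0 c0]] [w1 [a1 b1 c1]] [w3 [a3 b3 c3]].
have [v hv] : exists v : K 3, forall i, (i <= 3)%N -> i != 2%N ->
    face i v = nth w0 [:: w0; w1; w0; w3] i.
  apply: kanP => // i j.
  case/andP; case: i j => [|[|[|i]]] [|[|[|[|j]]]] //= _ _ _ _; congruence.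
exists (face 2 v); split.
- by rewrite (@face_face K _ 0 2) // hv //= b0.
- by rewrite (@face_face K _ 1 2) // hv //= b1.
- by have := @face_face K _ 2 3 v isT; rewrite /= hv //= c3.
Qed.

Lemma fill3 :
  triangle p q r -> triangle p s t -> triangle q s u -> triangle r t u.
Proof.
move=> [w0 [a0 b0 c0]] [w1 [a1 b1 c1]] [w2 [a2 b2 c2]].
have [v hv] : exists v : K 3, forall i, (i <= 3)%N -> i != 3%N ->
    face i v = nth w0 [:: w0; w1; w2; w0] i.
  apply: kanP => // i j.
  case/andP; case: i j => [|[|[|i]]] [|[|[|[|j]]]] //= _ _ _ _; congruence.
exists (face 3 v); split.
- by rewrite (@face_face K _ 0 3) // hv //= c0.
- by rewrite (@face_face K _ 1 3) // hv //= c1.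
- by rewrite (@face_face K _ 2 3) // hv //= c2.
Qed.

End Fill.

Lemma homotopic_refl x : homotopic x x.
Proof. exact: triangle1l. Qed.

Lemma homotopic_sym x y : homotopic x y -> homotopic y x.
Proof.
by move=> xy; apply: fill3 (triangle1l const_loop) xy (triangle1l x).
Qed.

Lemma homotopic_trans x y z : homotopic x y -> homotopic y z -> homotopic x z.
Proof. by move=> xy yz; apply: fill2 (triangle1l const_loop) xy yz. Qed.

Definition homotopicb (x y : {classic (K 1%N)}) : bool := `[< homotopic x y >].

Lemma homotopicb_refl : reflexive homotopicb.
Proof. by move=> x; apply/asboolP/homotopic_refl. Qed.
Lemma homotopicb_sym : symmetric homotopicb.
Proof. by move=> x y; apply/asboolP/asboolP => /homotopic_sym. Qed.
Lemma homotopicb_trans : transitive homotopicb.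
Proof.
move=> y x z /asboolP xy /asboolP yz; apply/asboolP.
exact: homotopic_trans xy yz.
Qed.

Canonical homotopic_equiv :=
  EquivRel homotopicb homotopicb_refl homotopicb_sym homotopicb_trans.

Definition pi1 : Type := {eq_quot homotopic_equiv}.

HB.instance Definition _ := Choice.on pi1.
HB.instance Definition _ := EqQuotient.on pi1.

Definition loop_class x : pi1 := \pi_pi1 (x : {classic (K 1%N)}).

Lemma loop_class_eq x y : loop_class x = loop_class y <-> homotopic x y.
Proof.
by split=> [/eqquotP/asboolP|xy] //; apply/eqquotP/asboolP.
Qed.

Definition loop_repr (a : pi1) : K 1%N := repr a.

Lemma loop_reprK (a : pi1) : loop_class (loop_repr a) = a.
Proof. exact: reprK. Qed.

Lemma loop_classP (a : pi1) : exists x, a = loop_class x.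
Proof. by exists (loop_repr a); rewrite loop_reprK. Qed.

Lemma triangle_homotopic a a' b b' c c' :
  triangle a b c -> triangle a' b' c' -> homotopic a a' -> homotopic c c' ->
  homotopic b b'.
Proof.
move=> abc abc' aa' cc'.
have h1 : triangle a' b c.
  exact: fill2 (homotopic_sym aa') (triangle1l b) abc.
have h2 : triangle a' b c'.
  by apply: fill1 (triangle1r a') h1 (homotopic_sym cc').
exact: fill1 (triangle1l a') h2 abc'.
Qed.

(* The product [a][c] is the class of the middle face of a filler.            *)
Definition pi1_one : pi1 := loop_class const_loop.
Definition pi1_mul (a c : pi1) : pi1 :=
  loop_class (projT1 (cid (triangle_mul (loop_repr a) (loop_repr c)))).
Definition pi1_inv (c : pi1) : pi1 :=
  loop_class (projT1 (cid (triangle_divl const_loop (loop_repr c)))).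

Lemma pi1_mulE a b c : triangle a b c ->
  pi1_mul (loop_class a) (loop_class c) = loop_class b.
Proof.
move=> abc; apply/loop_class_eq; case: cid => b' /= abc'.
by apply: triangle_homotopic abc' abc _ _; apply/loop_class_eq;
   rewrite loop_reprK.
Qed.

Lemma pi1_mulA : associative pi1_mul.
Proof.
move=> x y z.
have [p ->] := loop_classP x; have [r ->] := loop_classP y.
have [u ->] := loop_classP z.
have [q pqr] := triangle_mul p r; have [t rtu] := triangle_mul r u.
have [s qsu] := triangle_mul q u; have pst := fill1 pqr qsu rtu.
by rewrite (pi1_mulE pqr) (pi1_mulE rtu) (pi1_mulE pst) (pi1_mulE qsu).
Qed.

Lemma pi1_mul1g : left_id pi1_one pi1_mul.
Proof.
move=> x; have [p ->] := loop_classP x; exact: pi1_mulE (triangle1l p).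
Qed.

Lemma pi1_mulg1 : right_id pi1_one pi1_mul.
Proof.
move=> x; have [p ->] := loop_classP x; exact: pi1_mulE (triangle1r p).
Qed.

Lemma pi1_mulVg : left_inverse pi1_one pi1_inv pi1_mul.
Proof.
move=> x; rewrite /pi1_inv; case: cid => a /= h.
by rewrite -[in X in pi1_mul _ X](loop_reprK x) (pi1_mulE h).
Qed.

Lemma pi1_mulgV : right_inverse pi1_one pi1_inv pi1_mul.
Proof.
move=> x; rewrite -[LHS]pi1_mul1g -{1}(pi1_mulVg (pi1_inv x)).
by rewrite -pi1_mulA (pi1_mulA (pi1_inv x)) pi1_mulVg pi1_mul1g pi1_mulVg.
Qed.

HB.instance Definition _ := isGroup.Build pi1
  pi1_mulA pi1_mul1g pi1_mulg1 pi1_mulVg pi1_mulgV.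

Lemma loop_classM (w : K 2) :
  loop_class (face 1 w) = loop_class (face 0 w) * loop_class (face 2 w).
Proof. by apply/esym/pi1_mulE; exists w. Qed.

Lemma loop_class1 (v : K 0) : loop_class (degen 0 v) = 1.
Proof. by rewrite (vertexP v). Qed.

End FundamentalGroup.

(* Left actions; each [act g] is then a simplicial automorphism.              *)
Record simplicial_action (G : groupType) (K : sset) := SimplicialAction {
  act : G -> forall n : nat, K n -> K n;
  act1 : forall n (x : K n), act 1 x = x;
  actM : forall g h n (x : K n), act (g * h) x = act g (act h x);
  act_face : forall g n i (x : K n.+1), (i <= n.+1)%N ->
    act g (face i x) = face i (act g x);
  act_degen : forall g n i (x : K n), (i <= n)%N ->
    act g (degen i x) = degen i (act g x)
}.

Section InducedAction.
Variables (G : groupType) (K : kan1) (A : simplicial_action G K).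

Definition pi1_act_fun (g : G) (a : pi1 K) : pi1 K :=
  loop_class (act A g (loop_repr a)).

Lemma act_triangle g (a b c : K 1%N) :
  triangle a b c -> triangle (act A g a) (act A g b) (act A g c).
Proof.
by move=> [w [<- <- <-]]; exists (act A g w); split; rewrite act_face.
Qed.

Lemma act_const_loop g : act A g (const_loop K) = const_loop K.
Proof. by rewrite /const_loop act_degen // (vertexP (act A g _)). Qed.

Lemma pi1_act_funE g (x : K 1%N) :
  pi1_act_fun g (loop_class x) = loop_class (act A g x).
Proof.
apply/loop_class_eq; rewrite /homotopic -(act_const_loop g).
by apply: act_triangle; apply/loop_class_eq; rewrite loop_reprK.
Qed.

Lemma pi1_act_funM g : {morph pi1_act_fun g : a b / a * b}.
Proof.
move=> a b; have [x ->] := loop_classP a; have [y ->] := loop_classP b.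
have [z h] := triangle_mul x y.
have -> : loop_class x * loop_class y = loop_class z by exact: pi1_mulE h.
by rewrite !pi1_act_funE; apply/esym/pi1_mulE/act_triangle.
Qed.

Lemma pi1_act_funA g h a :
  pi1_act_fun (g * h) a = pi1_act_fun g (pi1_act_fun h a).
Proof. by have [x ->] := loop_classP a; rewrite !pi1_act_funE actM. Qed.

Lemma pi1_act_fun1 a : pi1_act_fun 1 a = a.
Proof. by have [x ->] := loop_classP a; rewrite pi1_act_funE act1. Qed.

Lemma pi1_act_funK g : cancel (pi1_act_fun g) (pi1_act_fun g^-1).
Proof. by move=> a; rewrite -pi1_act_funA mulVg pi1_act_fun1. Qed.
Lemma pi1_act_funVK g : cancel (pi1_act_fun g^-1) (pi1_act_fun g).
Proof. by move=> a; rewrite -pi1_act_funA mulgV pi1_act_fun1. Qed.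

Definition pi1_act (g : G) : aut (pi1 K) :=
  Aut (pi1_act_funM g) (pi1_act_funK g) (pi1_act_funVK g).

Lemma pi1_actE g (x : K 1%N) :
  pi1_act g (loop_class x) = loop_class (act A g x).
Proof. exact: pi1_act_funE. Qed.

Lemma pi1_actM : {morph pi1_act : g h / g * h}.
Proof. by move=> g h; apply: autP => a; apply: pi1_act_funA. Qed.

HB.instance Definition _ :=
  isMultiplicative.Build G (aut (pi1 K)) pi1_act pi1_actM.

End InducedAction.

Definition invariant_subgroup (G P : groupType) (psi : G -> aut P)
    (H : normal_subgroup P) : Prop :=
  forall g : G, (psi g @` [set` nsub H] = [set` nsub H])%classic.

Section QuotientAction.
Variables (G P : groupType) (psi : {multiplicative G -> aut P}).
Variables (H : normal_subgroup P) (Hinv : invariant_subgroup psi H).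

Definition quotient_act_fun (g : G) (a : quotient_group H) : quotient_group H :=
  coset H (psi g (repr a)).

Lemma quotient_act_funE g x :
  quotient_act_fun g (coset H x) = coset H (psi g x).
Proof.
apply/coset_eq.
have /coset_eq e : coset H (repr (coset H x)) = coset H x.
  exact: coset_repr.
rewrite -aut_funV -aut_funM.
suff : [set` nsub H]%classic (psi g ((repr (coset H x))^-1 * x)) by [].
by rewrite -(Hinv g); exists ((repr (coset H x))^-1 * x).
Qed.

Lemma quotient_act_funM g : {morph quotient_act_fun g : a b / a * b}.
Proof.
move=> a b; have [x ->] := cosetP a; have [y ->] := cosetP b.
by rewrite -cosetM !quotient_act_funE aut_funM cosetM.
Qed.

Lemma quotient_act_funA g h a :
  quotient_act_fun (g * h) a = quotient_act_fun g (quotient_act_fun h a).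
Proof. by have [x ->] := cosetP a; rewrite !quotient_act_funE gmulfM. Qed.

Lemma quotient_act_fun1 a : quotient_act_fun 1 a = a.
Proof. by have [x ->] := cosetP a; rewrite quotient_act_funE mult1. Qed.

Lemma quotient_act_funK g : cancel (quotient_act_fun g) (quotient_act_fun g^-1).
Proof. by move=> a; rewrite -quotient_act_funA mulVg quotient_act_fun1. Qed.
Lemma quotient_act_funVK g :
  cancel (quotient_act_fun g^-1) (quotient_act_fun g).
Proof. by move=> a; rewrite -quotient_act_funA mulgV quotient_act_fun1. Qed.

Definition quotient_act (g : G) : aut (quotient_group H) :=
  Aut (quotient_act_funM g) (quotient_act_funK g) (quotient_act_funVK g).

Lemma quotient_actE g x : quotient_act g (coset H x) = coset H (psi g x).
Proof. exact: quotient_act_funE. Qed.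

Lemma quotient_actM : {morph quotient_act : g h / g * h}.
Proof. by move=> g h; apply: autP => a; apply: quotient_act_funA. Qed.

HB.instance Definition _ :=
  isMultiplicative.Build G (aut (quotient_group H)) quotient_act quotient_actM.

End QuotientAction.

Section Cover.
Variables (K : kan1) (H : normal_subgroup (pi1 K)).

(* The iterated face d_0^n of an (n+1)-simplex.                               *)
Fixpoint last_edge (n : nat) : K n.+1 -> K 1%N :=
  match n return K n.+1 -> K 1%N with
  | 0 => id
  | m.+1 => fun x => last_edge (face 0 x)
  end.

Definition edge_coset (n : nat) (x : K n.+1) : quotient_group H :=
  coset H (loop_class (last_edge x)).

Lemma edge_coset_face n i (x : K n.+2) : (i <= n)%N ->
  edge_coset (face i x) = edge_coset x.
Proof.
rewrite /edge_coset; elim: n i x => [|n IH] [|i] x //= ltin.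
have lein : (i <= n)%N by [].
rewrite (@face_face K _ 0 i.+1); first exact: IH.
exact: leq_trans lein (leqW (leqnSn n)).
Qed.

Lemma edge_coset_face_last n (x : K n.+2) :
  edge_coset (face n.+1 x) = edge_coset x * edge_coset (face n.+2 x).
Proof.
rewrite /edge_coset; elim: n x => [|n IH] x /=.
  by rewrite loop_classM cosetM.
by rewrite (@face_face K _ 0 n.+2) ?leqnSn // (@face_face K _ 0 n.+3) ?leqnn.
Qed.

Lemma edge_coset_degen n i (x : K n.+1) : (i <= n)%N ->
  edge_coset (degen i x) = edge_coset x.
Proof.
rewrite /edge_coset; elim: n i x => [|n IH] [|i] x //= ltin.
- by rewrite face_degen_id.
- by rewrite face_degen_id.
- rewrite face_degen_lt //=; first exact: (IH i (face 0 x)).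
  by rewrite ltnW.
Qed.

Lemma edge_coset_degen_last n (x : K n) : edge_coset (degen n x) = 1.
Proof.
rewrite /edge_coset; elim: n x => [|n IH] x /=.
  by rewrite loop_class1.
by rewrite face_degen_lt //= ?leqnn.
Qed.

Definition cover_simplex (n : nat) : Type := (K n * quotient_group H)%type.

Definition cover_face (n i : nat) (y : cover_simplex n.+1) : cover_simplex n :=
  (face i y.1, if i == n.+1 then (edge_coset y.1)^-1 * y.2 else y.2).

Definition cover_degen (n i : nat) (y : cover_simplex n) : cover_simplex n.+1 :=
  (degen i y.1, y.2).

Lemma cover_face_face n i j (y : cover_simplex n.+2) : (i < j <= n.+2)%N ->
  cover_face i (cover_face j y) = cover_face j.-1 (cover_face i y).
Proof.
case: y => x a ij; rewrite /cover_face /= face_face //; congr pair.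
have /andP[ltij lejn] := ij.
rewrite (ltn_eqF (leq_trans ltij lejn)).
have -> : (j.-1 == n.+1) = (j == n.+2) by case: j {ij lejn} ltij.
have [ej|jn] := eqVneq j n.+2.
  rewrite ej in ltij *; have [->|in1] := eqVneq i n.+1.
    by rewrite edge_coset_face_last invgM mulgA.
  by rewrite edge_coset_face // -ltnS ltn_neqAle in1.
have ltjn : (j < n.+2)%N by rewrite ltn_neqAle jn.
by rewrite (ltn_eqF (leq_trans ltij (ltjn : (j <= n.+1)%N))).
Qed.

Lemma cover_face_degen_lt n i j (y : cover_simplex n.+1) : (i < j <= n.+1)%N ->
  cover_face i (cover_degen j y) = cover_degen j.-1 (cover_face i y).
Proof.
move=> ij; rewrite /cover_face /cover_degen /= face_degen_lt //.
have /andP[ltij lejn] := ij; have ltin := leq_trans ltij lejn.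
by rewrite !ltn_eqF // ltnS ltnW.
Qed.

Lemma cover_face_degen_id n j (y : cover_simplex n) : (j <= n)%N ->
  cover_face j (cover_degen j y) = y.
Proof.
move=> jn; rewrite /cover_face /cover_degen /= face_degen_id //.
by rewrite ltn_eqF ?ltnS //; case: y.
Qed.

Lemma cover_face_degen_succ n j (y : cover_simplex n) : (j <= n)%N ->
  cover_face j.+1 (cover_degen j y) = y.
Proof.
case: y => x a jn; rewrite /cover_face /cover_degen /= face_degen_succ //.
rewrite eqSS; have [->|//] := eqVneq j n.
by rewrite edge_coset_degen_last invg1 mul1g.
Qed.

Lemma cover_face_degen_gt n i j (y : cover_simplex n.+1) :
  (j.+1 < i <= n.+2)%N ->
  cover_face i (cover_degen j y) = cover_degen j (cover_face i.-1 y).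
Proof.
move=> ji; rewrite /cover_face /cover_degen /= face_degen_gt //; congr pair.
case: i ji => [|i] //= /andP[ji lein]; rewrite eqSS; case: eqP => // ein.
by rewrite edge_coset_degen // -ltnS -ein.
Qed.

Lemma cover_degen_degen n i j (y : cover_simplex n) : (i <= j <= n)%N ->
  cover_degen i (cover_degen j y) = cover_degen j.+1 (cover_degen i y).
Proof. by move=> ij; rewrite /cover_degen /= degen_degen. Qed.

Definition regular_cover : sset := SSet
  cover_face_face cover_face_degen_lt cover_face_degen_id cover_face_degen_succ
  cover_face_degen_gt cover_degen_degen.

Definition cover_proj (n : nat) (y : regular_cover n) : K n := y.1.

End Cover.

Section AssociatedExtension.
Variables (G : groupType) (K : kan1) (A : simplicial_action G K).
Variables (H : normal_subgroup (pi1 K)).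
Variable Hinv : invariant_subgroup (pi1_act A) H.

Definition induced_hom : {multiplicative G -> aut (quotient_group H)} :=
  quotient_act Hinv.

Definition associated_group : groupType := semidirect induced_hom.

Definition cover_act_fun (l : associated_group) (n : nat)
    (y : regular_cover H n) : regular_cover H n :=
  (act A l.2 y.1, induced_hom l.2 y.2 * l.1^-1).

Lemma cover_act1 n (y : regular_cover H n) : cover_act_fun 1 y = y.
Proof.
case: y => x s; transitivity (act A 1 x, induced_hom 1 s * 1^-1) => //.
by rewrite act1 mult1 aut1_app invg1 mulg1.
Qed.

Lemma cover_actM l m n (y : regular_cover H n) :
  cover_act_fun (l * m) y = cover_act_fun l (cover_act_fun m y).
Proof.
case: l m y => [a f] [b g] [x s].
transitivity (act A f (act A g x),
              induced_hom (f * g) s * (a * induced_hom f b)^-1).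
  by rewrite -actM.
by rewrite gmulfM autM_app invgM mulgA -aut_funV -aut_funM.
Qed.

Lemma act_edge_coset g n (x : K n.+1) :
  edge_coset H (act A g x) = induced_hom g (edge_coset H x).
Proof.
rewrite /edge_coset quotient_actE pi1_actE; congr (coset H (loop_class _)).
by elim: n x => //= n IH x; rewrite -act_face // IH.
Qed.

Lemma cover_act_face l n i (y : regular_cover H n.+1) : (i <= n.+1)%N ->
  cover_act_fun l (face i y) = face i (cover_act_fun l y).
Proof.
case: l y => [a f] [x s] lein.
have twist : induced_hom f ((edge_coset H x)^-1 * s) * a^-1 =
             (edge_coset H (act A f x))^-1 * (induced_hom f s * a^-1).
  by rewrite act_edge_coset aut_funM aut_funV mulgA.
rewrite /cover_act_fun /= /cover_face /= act_face //; case: eqP => _ //.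
by congr pair; exact: twist.
Qed.

Lemma cover_act_degen l n i (y : regular_cover H n) : (i <= n)%N ->
  cover_act_fun l (degen i y) = degen i (cover_act_fun l y).
Proof.
by move=> lein; rewrite /cover_act_fun /= /cover_degen /= act_degen.
Qed.

Definition cover_act : simplicial_action associated_group (regular_cover H) :=
  SimplicialAction cover_act1 cover_actM cover_act_face cover_act_degen.

End AssociatedExtension.

(* Main.v *)
Require Import Defs.
From HB Require Import structures.
From mathcomp Require Import all_boot.
From mathcomp Require Import fingroup.
From mathcomp Require Import generic_quotient boolp classical_sets zify.

Set Implicit Arguments.
Unset Strict Implicit.
Unset Printing Implicit Defensive.

(** The complex [K] enters only through the group N = pi / H: the extension is
    already realised by the classifying space K' = BN, on which [G] acts
    functorially through [phi], with H' the trivial subgroup of pi_1(BN) = N.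

    An n-simplex of BN is a family of edge labels in N, one for each pair
    a <= b of vertices, with label(a,c) = label(b,c) label(a,b), in accordance
    with the product of [pi1].  Such a family is the same thing as a vertex
    potential f with f 0 = 1, the labels being f b (f a)^-1; in this form a
    simplicial operator precomposes f with a map of vertices and then multiplies
    on the right to restore f 0 = 1 ([based]), so that the simplicial identities
    are identities between maps of vertices ([based_based]).

    BN is a Kan complex ([nerve_kan]) because all the edges at the vertex k lie
    in the horn opposite to the k-th face, and these edges determine a unique
    potential.  A 2-simplex expresses a product in N, hence homotopic loops
    are equal, and reading off the label of a loop is an isomorphism from
    pi_1(BN) to N ([nerve_label_bij]) which carries the induced action of [G] to
    [phi] ([nerve_label_act]).  The semidirect product is functorial in the pair
    formed by the group and its action ([semidirect_iso]), so the associated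
    extension is isomorphic to the given one. *)

(** * The classifying space of a group *)

Section Nerve.
Variable N : groupType.
Local Open Scope group_scope.

(** A function on [nat] avoids arithmetic in ordinal types; the value 1 beyond
    the last vertex makes pointwise equality on the vertices an equality of
    simplices. *)
Record nerve_simplex (n : nat) := NerveSimplex {
  potential :> nat -> N;
  potential0 : potential 0 = 1;
  potential_out : forall k, (n < k)%N -> potential k = 1
}.

Lemma nerve_simplexP n (x y : nerve_simplex n) :
  (forall k, (k <= n)%N -> x k = y k) -> x = y.
Proof.
case: x y => [f f0 fo] [g g0 go] /= fg.
have efg : f = g.
  by apply/funext => k; case: (leqP k n) => [/fg|nk] //; rewrite fo ?go.
by case: _ / efg in g0 go fg *; congr NerveSimplex; apply: Prop_irrelevance.
Qed.

Definition based_fun n (f : nat -> N) (k : nat) : N :=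
  if (k <= n)%N then f k * (f 0)^-1 else 1.

Lemma based_fun0 n f : based_fun n f 0 = 1.
Proof. by rewrite /based_fun mulgV. Qed.

Lemma based_fun_out n f k : (n < k)%N -> based_fun n f k = 1.
Proof. by rewrite /based_fun ltnNge; case: leqP. Qed.

Definition based n (f : nat -> N) : nerve_simplex n :=
  NerveSimplex (based_fun0 n f) (@based_fun_out n f).

Lemma basedE n f k : (k <= n)%N -> based n f k = f k * (f 0)^-1.
Proof. by rewrite /= /based_fun => ->. Qed.

Lemma eq_based n f g : (forall k, (k <= n)%N -> f k = g k) ->
  based n f = based n g.
Proof.
by move=> fg; apply: nerve_simplexP => k kn; rewrite !basedE // !fg.
Qed.

Lemma based_id n (x : nerve_simplex n) : based n x = x.
Proof.
by apply: nerve_simplexP => k kn; rewrite basedE // potential0 invg1 mulg1.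
Qed.

Definition edge (f : nat -> N) (a b : nat) : N := f b * (f a)^-1.

Lemma edge_comp f a b c : edge f b c * edge f a b = edge f a c.
Proof. by rewrite /edge mulgA mulgKV. Qed.

Lemma edge_div f a b c : edge f a c * (edge f a b)^-1 = edge f b c.
Proof. by rewrite -(edge_comp f a b c) mulgK. Qed.

(** The edge labels do not see the right factor by which a potential is
    normalised. *)
Lemma edge_based n f a b : (a <= n)%N -> (b <= n)%N ->
  edge (based n f) a b = edge f a b.
Proof. by move=> an bn; rewrite /edge !basedE // invgM invgK mulgA mulgKV. Qed.

Lemma edge_id n (x : nerve_simplex n) k : edge x 0 k = x k.
Proof. by rewrite /edge potential0 invg1 mulg1. Qed.

Lemma based_based m n (t : nat -> nat) f :
  (forall k, (k <= m)%N -> (t k <= n)%N) ->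
  based m (based n f \o t) = based m (f \o t).
Proof.
move=> tn; apply: nerve_simplexP => k km; rewrite !basedE //.
exact: edge_based (tn _ (leq0n m)) (tn _ km).
Qed.

Definition nerve_face n i (x : nerve_simplex n.+1) : nerve_simplex n :=
  based n (x \o bump i).
Definition nerve_degen n i (x : nerve_simplex n) : nerve_simplex n.+1 :=
  based n.+1 (x \o unbump i).

Lemma nerve_face_face n i j (x : nerve_simplex n.+2) : (i < j <= n.+2)%N ->
  nerve_face i (nerve_face j x) = nerve_face j.-1 (nerve_face i x).
Proof.
move=> ij; rewrite /nerve_face !based_based; first last.
- by move=> k; rewrite /bump; lia.
- by move=> k; rewrite /bump; lia.
by apply: eq_based => k kn; congr (x _); rewrite /bump; lia.
Qed.

Lemma nerve_face_degen_lt n i j (x : nerve_simplex n.+1) : (i < j <= n.+1)%N ->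
  nerve_face i (nerve_degen j x) = nerve_degen j.-1 (nerve_face i x).
Proof.
move=> ij; rewrite /nerve_face /nerve_degen !based_based; first last.
- by move=> k; rewrite /bump; lia.
- by move=> k; rewrite /unbump; lia.
by apply: eq_based => k kn; congr (x _); rewrite /bump /unbump; lia.
Qed.

Lemma nerve_face_degen_id n j (x : nerve_simplex n) : (j <= n)%N ->
  nerve_face j (nerve_degen j x) = x.
Proof.
move=> jn; rewrite /nerve_face /nerve_degen based_based; last first.
  by move=> k; rewrite /bump; lia.
rewrite -[RHS]based_id.
by apply: eq_based => k kn; congr (x _); rewrite /bump /unbump; lia.
Qed.

Lemma nerve_face_degen_succ n j (x : nerve_simplex n) : (j <= n)%N ->
  nerve_face j.+1 (nerve_degen j x) = x.
Proof.
move=> jn; rewrite /nerve_face /nerve_degen based_based; last first.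
  by move=> k; rewrite /bump; lia.
rewrite -[RHS]based_id.
by apply: eq_based => k kn; congr (x _); rewrite /bump /unbump; lia.
Qed.

Lemma nerve_face_degen_gt n i j (x : nerve_simplex n.+1) :
  (j.+1 < i <= n.+2)%N ->
  nerve_face i (nerve_degen j x) = nerve_degen j (nerve_face i.-1 x).
Proof.
move=> ij; rewrite /nerve_face /nerve_degen !based_based; first last.
- by move=> k; rewrite /bump; lia.
- by move=> k; rewrite /unbump; lia.
by apply: eq_based => k kn; congr (x _); rewrite /bump /unbump; lia.
Qed.

Lemma nerve_degen_degen n i j (x : nerve_simplex n) : (i <= j <= n)%N ->
  nerve_degen i (nerve_degen j x) = nerve_degen j.+1 (nerve_degen i x).
Proof.
move=> ij; rewrite /nerve_degen !based_based; first last.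
- by move=> k; rewrite /unbump; lia.
- by move=> k; rewrite /unbump; lia.
by apply: eq_based => k kn; congr (x _); rewrite /unbump; lia.
Qed.

Definition nerve_sset : sset := SSet
  nerve_face_face nerve_face_degen_lt nerve_face_degen_id nerve_face_degen_succ
  nerve_face_degen_gt nerve_degen_degen.

Lemma edge_face n i (x : nerve_sset n.+1) a b : (a <= n)%N -> (b <= n)%N ->
  edge (face i x) a b = edge x (bump i a) (bump i b).
Proof. exact: edge_based. Qed.

(** Two given faces containing an edge agree on their common face, and the edge
    lies in it; so its label does not depend on the face [i] in which it is
    read.  Here [unbump i] converts a vertex of the whole simplex into its rank
    in the i-th face. *)
Lemma horn_edge n (k : nat) (y : nat -> nerve_sset n.+1) :
  (forall i j, (i < j <= n.+2)%N -> i != k -> j != k ->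
     face i (y j) = face j.-1 (y i)) ->
  forall i j a b, (i <= n.+2)%N -> (j <= n.+2)%N -> i != k -> j != k ->
    (a <= n.+2)%N -> (b <= n.+2)%N ->
    a != i -> a != j -> b != i -> b != j ->
    edge (y i) (unbump i a) (unbump i b) = edge (y j) (unbump j a) (unbump j b).
Proof.
move=> yC i j a b; wlog ij : i j / (i < j)%N => [hw|] lin ljn ik jk an bn ai aj.
  move=> bi bj; have [e|ne] := eqVneq i j; first by rewrite e.
  have [lij|lji] : (i < j \/ j < i)%N by lia.
    exact: hw.
  by apply/esym/hw.
move=> bi bj.
(* The ranks of [a] and [b] in the common face of the faces [i] and [j]. *)
pose a' := unbump i (unbump j a); pose b' := unbump i (unbump j b).
have -> : unbump i a = bump j.-1 a' by rewrite /a' /bump /unbump; lia.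
have -> : unbump j a = bump i a' by rewrite /a' /bump /unbump; lia.
have -> : unbump i b = bump j.-1 b' by rewrite /b' /bump /unbump; lia.
have -> : unbump j b = bump i b' by rewrite /b' /bump /unbump; lia.
have a'n : (a' <= n)%N by rewrite /a' /unbump; lia.
have b'n : (b' <= n)%N by rewrite /b' /unbump; lia.
by rewrite -!edge_face // (yC i j) // ij.
Qed.

(** Every edge at the vertex [k] lies in a face other than the k-th, since a
    simplex of dimension at least 2 has a third vertex.  The labels of these
    edges form a potential with origin [k], which restricts correctly to each
    given face because that face contains [k]. *)
Lemma nerve_kan : is_kan nerve_sset.
Proof.
move=> n k y kn yC; have yE := horn_edge yC.
have third a : exists i, [/\ (i <= 2)%N, i != k & a != i].
  have [/andP[]|[/andP[]|/andP[]]] : ((0 != k) && (a != 0) \/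
      (1 != k) && (a != 1) \/ (2 != k) && (a != 2))%N by lia.
  - by exists 0%N.
  - by exists 1%N.
  - by exists 2%N.
have /choice[c hc] := third.
pose f a := edge (y (c a)) (unbump (c a) k) (unbump (c a) a).
exists (based n.+2 f) => i lin ik; apply: nerve_simplexP => t tn.
rewrite -!edge_id edge_face //.
have tn2 : (bump i t <= n.+2)%N by rewrite /bump; lia.
have on2 : (bump i 0 <= n.+2)%N by rewrite /bump; lia.
rewrite edge_based //.
have fE a : (a <= n.+2)%N -> a != i ->
    f a = edge (y i) (unbump i k) (unbump i a).
  move=> an ai; have [c2 ck ac] := hc a.
  by apply: yE => //; [exact: leq_trans c2 _ | rewrite eq_sym | rewrite eq_sym].
rewrite {1}/edge !fE ?(eq_sym _ i) ?neq_bump //.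
by rewrite edge_div !bumpK.
Qed.

Lemma nerve_vertexP (v : nerve_sset 0) : v = based 0 (fun=> 1).
Proof. by apply: nerve_simplexP => -[|k] // _; rewrite !potential0. Qed.

Definition nerve : kan1 := OneVertexKan nerve_vertexP nerve_kan.

(** * The fundamental group of the classifying space *)

Lemma nerve_loopP (x y : nerve 1%N) : x 1%N = y 1%N -> x = y.
Proof.
by move=> xy; apply: nerve_simplexP => -[|[|k]] //; rewrite !potential0.
Qed.

Lemma nerve_triangle (a b c : nerve 1%N) :
  triangle a b c -> b 1%N = a 1%N * c 1%N.
Proof.
by move=> [w [<- <- <-]]; rewrite -!edge_id !edge_face //= edge_comp.
Qed.

Lemma nerve_homotopic (x y : nerve 1%N) : homotopic x y <-> x = y.
Proof.
split=> [/nerve_triangle e|->]; last exact: homotopic_refl.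
apply: nerve_loopP; apply/esym; rewrite e /= /based_fun /=.
by rewrite mulgV mul1g.
Qed.

Definition nerve_label (a : pi1 nerve) : N := loop_repr a 1%N.

Lemma nerve_labelE (x : nerve 1%N) : nerve_label (loop_class x) = x 1%N.
Proof.
congr (potential _ 1%N); apply/nerve_homotopic/loop_class_eq.
exact: loop_reprK.
Qed.

Lemma nerve_labelM : {morph nerve_label : a b / a * b}.
Proof.
move=> a b; have [x ->] := loop_classP a; have [y ->] := loop_classP b.
have [z h] := triangle_mul x y.
have -> : loop_class x * loop_class y = loop_class z by exact: pi1_mulE h.
by rewrite !nerve_labelE (nerve_triangle h).
Qed.

HB.instance Definition _ :=
  isMultiplicative.Build (pi1 nerve) N nerve_label nerve_labelM.

Definition nerve_loop (g : N) : nerve 1%N :=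
  based 1 (fun k => if k is 0 then 1 else g).

Lemma nerve_label_bij : bijective nerve_label.
Proof.
exists (fun g => loop_class (nerve_loop g)) => [a|g].
  have [x ->] := loop_classP a; congr loop_class; apply: nerve_loopP.
  by rewrite nerve_labelE /nerve_loop basedE //= invg1 mulg1.
by rewrite nerve_labelE /nerve_loop basedE //= invg1 mulg1.
Qed.

(** * Functoriality of the classifying space *)

Section Action.
Variables (G : groupType) (phi : {multiplicative G -> aut N}).

Definition nerve_act_fun (g : G) n (x : nerve n) : nerve n :=
  based n (phi g \o x).

Lemma nerve_act_funE g n (x : nerve n) k : (k <= n)%N ->
  nerve_act_fun g x k = phi g (x k).
Proof.
by move=> kn; rewrite basedE //= potential0 aut_fun1 invg1 mulg1.
Qed.

Lemma nerve_act1 n (x : nerve n) : nerve_act_fun 1 x = x.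
Proof. by apply: nerve_simplexP => k kn; rewrite nerve_act_funE // mult1. Qed.

Lemma nerve_actM g h n (x : nerve n) :
  nerve_act_fun (g * h) x = nerve_act_fun g (nerve_act_fun h x).
Proof.
by apply: nerve_simplexP => k kn; rewrite !nerve_act_funE // gmulfM autM_app.
Qed.

(** The action permutes the labels while a simplicial operator acts on the
    vertices; both commute with normalisation, hence with each other. *)
Lemma nerve_act_based g m n (t : nat -> nat) (x : nerve n) :
  (forall k, (k <= m)%N -> (t k <= n)%N) ->
  nerve_act_fun g (based m (x \o t) : nerve m) =
  based m (nerve_act_fun g x \o t).
Proof.
move=> tn; apply: nerve_simplexP => k km.
rewrite nerve_act_funE // !basedE //= -/(nerve_act_fun g x).
by rewrite aut_funM aut_funV -!nerve_act_funE ?tn.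
Qed.

Lemma nerve_act_face g n i (x : nerve n.+1) : (i <= n.+1)%N ->
  nerve_act_fun g (face i x) = face i (nerve_act_fun g x).
Proof. by move=> lin; apply: nerve_act_based => k; rewrite /bump; lia. Qed.

Lemma nerve_act_degen g n i (x : nerve n) : (i <= n)%N ->
  nerve_act_fun g (degen i x) = degen i (nerve_act_fun g x).
Proof. by move=> lin; apply: nerve_act_based => k; rewrite /unbump; lia. Qed.

Definition nerve_act : simplicial_action G nerve :=
  SimplicialAction nerve_act1 nerve_actM nerve_act_face nerve_act_degen.

Lemma nerve_label_act g (a : pi1 nerve) :
  nerve_label (pi1_act nerve_act g a) = phi g (nerve_label a).
Proof.
have [x ->] := loop_classP a.
by rewrite pi1_actE !nerve_labelE nerve_act_funE.
Qed.

End Action.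

End Nerve.

(** * Quotients by the trivial subgroup *)

Section TrivialSubgroup.
Variable P : groupType.
Local Open Scope group_scope.

Definition trivial_pred : {pred P} := pred1 1.

Lemma trivial_predE (x : P) : (x \in trivial_pred) = (x == 1).
Proof. by []. Qed.

Lemma trivial_predV : invg_closed trivial_pred.
Proof. by move=> x; rewrite !trivial_predE => /eqP ->; rewrite invg1. Qed.
Lemma trivial_pred1 : 1 \in trivial_pred.
Proof. by rewrite trivial_predE. Qed.
Lemma trivial_predM : mulg_closed trivial_pred.
Proof.
by move=> x y; rewrite !trivial_predE => /eqP -> /eqP ->; rewrite mulg1.
Qed.

Definition trivial_closed : groupClosed P := HB.pack trivial_pred
  (isInvClosed.Build P trivial_pred trivial_predV)
  (isMul1Closed.Build P trivial_pred trivial_pred1)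
  (isMulClosed.Build P trivial_pred trivial_predM).

Lemma trivial_closed_conj (x y : P) :
  x \in trivial_closed -> x ^ y \in trivial_closed.
Proof. by rewrite !trivial_predE => /eqP ->; rewrite conj1g. Qed.

Definition trivial_subgroup : normal_subgroup P :=
  NormalSubgroup trivial_closed_conj.

Lemma coset_trivial_inj : injective (coset trivial_subgroup).
Proof.
move=> x y /coset_eq; rewrite trivial_predE => /eqP e.
by rewrite -[y](mulVKg x) e mulg1.
Qed.

Lemma trivial_invariant (G : groupType) (psi : G -> aut P) :
  invariant_subgroup psi trivial_subgroup.
Proof.
move=> g; apply/seteqP; split=> x /=.
  by case=> y; rewrite /= !trivial_predE => /eqP -> <-; rewrite aut_fun1.
by rewrite trivial_predE => /eqP ->; exists 1; rewrite /= ?trivial_predE ?aut_fun1.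
Qed.

End TrivialSubgroup.

(** * Extensions attached to isomorphic actions *)

Section ExtensionIso.
Variables (G P N : groupType) (psi : {multiplicative G -> aut P}).
Variables (phi : {multiplicative G -> aut N}) (f : {multiplicative P -> N}).
Hypotheses (f_bij : bijective f) (f_act : forall g a, f (psi g a) = phi g (f a)).
Local Open Scope group_scope.

Let H := trivial_subgroup P.
Let Hinv : invariant_subgroup psi H := trivial_invariant psi.

Definition quotient_iso (a : quotient_group H) : N := f (repr a).

Lemma quotient_isoE x : quotient_iso (coset H x) = f x.
Proof. by congr (f _); apply: coset_trivial_inj; rewrite coset_repr. Qed.

Lemma quotient_isoM : {morph quotient_iso : a b / a * b}.
Proof.
move=> a b; have [x ->] := cosetP a; have [y ->] := cosetP b.
by rewrite -cosetM !quotient_isoE gmulfM.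
Qed.

HB.instance Definition _ :=
  isMultiplicative.Build (quotient_group H) N quotient_iso quotient_isoM.

Lemma quotient_iso_bij : bijective quotient_iso.
Proof.
case: f_bij => f' fK f'K; exists (fun y => coset H (f' y)) => [a|y].
  by have [x ->] := cosetP a; rewrite quotient_isoE fK.
by rewrite quotient_isoE f'K.
Qed.

Lemma quotient_iso_act g a :
  quotient_iso (quotient_act Hinv g a) = phi g (quotient_iso a).
Proof.
by have [x ->] := cosetP a; rewrite quotient_actE !quotient_isoE f_act.
Qed.

Definition semidirect_iso (l : semidirect (quotient_act Hinv)) :
  semidirect phi := (quotient_iso l.1, l.2).

Lemma semidirect_isoM : {morph semidirect_iso : l m / l * m}.
Proof.
move=> [a g] [b h]; congr pair.
by rewrite [LHS]quotient_isoM quotient_iso_act.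
Qed.

Lemma semidirect_iso_bij : bijective semidirect_iso.
Proof.
case: quotient_iso_bij => q' qK q'K.
by exists (fun m => (q' m.1, m.2)) => -[a g];
   rewrite /semidirect_iso /= ?qK ?q'K.
Qed.

End ExtensionIso.

Theorem theorem5p3 (K : kan1) (H : normal_subgroup (pi1 K)) (G : finGroupType)
    (phi : {multiplicative G -> aut (quotient_group H)}) :
  exists (K' : kan1) (A : simplicial_action G K')
         (H' : normal_subgroup (pi1 K'))
         (Hinv : invariant_subgroup (pi1_act A) H'),
    (forall (l : associated_group Hinv) (n : nat) (y : regular_cover H' n),
       cover_proj (act (cover_act Hinv) l y) = act A (sd_proj l) (cover_proj y)) /\
    exists (u : {multiplicative quotient_group H' -> quotient_group H})
           (v : {multiplicative associated_group Hinv -> semidirect phi}),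
      [/\ bijective u, bijective v,
          forall a : quotient_group H',
            v (sd_in (induced_hom Hinv) a) = sd_in phi (u a)
        & forall l : associated_group Hinv, sd_proj (v l) = sd_proj l].
Proof.
pose f := @nerve_label (quotient_group H); pose A := nerve_act phi.
pose Hinv := trivial_invariant (pi1_act A).
pose v : associated_group Hinv -> semidirect phi := @semidirect_iso _ _ _ _ phi f.
have vM := isMultiplicative.Build _ _ v (semidirect_isoM (nerve_label_act phi)).
pose v' : {multiplicative associated_group Hinv -> semidirect phi} :=
  HB.pack v vM.
exists (nerve (quotient_group H)), A, (trivial_subgroup _), Hinv.
split=> //; exists (quotient_iso f), v'; split=> //.
- exact/quotient_iso_bij/nerve_label_bij.
- exact/semidirect_iso_bij/nerve_label_bij.
Qed.
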